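(* Let $m\in\mathbb{N}$ and let $A=\{A(k)\}_{k\in\mathbb{Z}}$, $B=\{B(k)\}_{k\in\mathbb{Z}}$ be sequences of self-adjoint $m\times m$ matrices with $A(k)>0$ for all $k\in\mathbb{Z}$ and $\|A(k)\|_{\mathbb{C}^{m\times m}}+\|B(k)\|_{\mathbb{C}^{m\times m}}\le C$ for some $C>0$ and all $k\in\mathbb{Z}$. Let $H$ be the associated Jacobi operator in $\ell^2(\mathbb{Z})^m$, with Green's matrix $G(z,k,\ell)$ and diagonal Green's matrix $g(z,k)=G(z,k,k)$. Let $k_0\in\mathbb{Z}$. Then any one of the following three sets of data (i) $g(z,k_0)$ and $G(z,k_0,k_0+1)$ for all $z\in\mathbb{C}_+$; (ii) $g(z,k_0)$ and $[G(z,k_0,k_0+1)+G(z,k_0+1,k_0)]$ for all $z\in\mathbb{C}_+$; (iii) $g(z,k_0)$, $g(z,k_0+1)$ for all $z\in\mathbb{C}_+$ and $A(k_0)$; uniquely determines the matrix-valued Jacobi operator $H$ and hence $A=\{A(k)\}_{k\in\mathbb{Z}}$ and $B=\{B(k)\}_{k\in\mathbb{Z}}$.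
   Context: The Jacobi operator $H$ is the bounded self-adjoint operator on $\ell^2(\mathbb{Z})^m$ given by $(Hf)(k)=A(k)f(k+1)+A(k-1)f(k-1)+B(k)f(k)$, $k\in\mathbb{Z}$. Its Green's matrix is $G(z,k,\ell)=(H-z)^{-1}(k,\ell)\in\mathbb{C}^{m\times m}$, the $(k,\ell)$ block of the resolvent, $z\in\mathbb{C}\setminus\mathbb{R}$, $k,\ell\in\mathbb{Z}$. $\mathbb{C}_+$ is the open upper half-plane. ''Data uniquely determine $H$'' means: two Jacobi operators of the class considered having the same data have identical coefficient sequences $A$ and $B$. *)

(* Defs.v *)
From HB Require Import structures.
From mathcomp Require Export all_boot all_order all_algebra.
From mathcomp Require Export all_classical all_reals all_analysis.
From mathcomp Require Export complex.

Set Implicit Arguments.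
Unset Strict Implicit.
Unset Printing Implicit Defensive.

Import Order.TTheory GRing.Theory Num.Theory.
Local Open Scope classical_set_scope.
Local Open Scope ring_scope.
Local Open Scope sesquilinear_scope.

Section JacobiOperators.
Context {R : realType} {m : nat}.
Local Notation C := R[i].
Implicit Types (A B : int -> 'M[C]_m) (f : int -> 'cV[C]_m) (z : C).

Definition cnorm (v : 'cV[C]_m) : R :=
  Num.sqrt (\sum_i ComplexField.Normc.normc (v i 0) ^+ 2).

Definition opnorm (M : 'M[C]_m) : R :=
  sup [set cnorm (M *m v) | v in [set v : 'cV[C]_m | cnorm v <= 1]].

(* 0 < x in R[i] says that x is real and positive. *)
Definition posdefmx (M : 'M[C]_m) : Prop :=
  M \is hermsymmx /\
  forall v : 'cV[C]_m, v != 0 -> 0 < (v ^t* *m M *m v) 0 0.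

Record jacobi_coefficients A B : Prop := JacobiCoefficients {
  jacobi_posdef : forall k, posdefmx (A k);
  jacobi_hermitian : forall k, B k \is hermsymmx;
  jacobi_bounded :
    exists c : R, 0 < c /\ forall k, opnorm (A k) + opnorm (B k) <= c }.

(* The Hilbert space l^2(Z)^m, as a set of sequences. *)
Definition l2 : set (int -> 'cV[C]_m) :=
  [set f | (\esum_(k in [set: int]) (cnorm (f k) ^+ 2)%:E < +oo)%E].

Definition jacobi A B f : int -> 'cV[C]_m :=
  fun k => A k *m f (k + 1) + A (k - 1) *m f (k - 1) + B k *m f k.

(* (H - z)^-1, where H is the restriction of [jacobi A B] to [l2]: 'pinv is the
   inverse of H - z : l2 -> l2. Under [jacobi_coefficients A B], and for z not
   real, H - z is a bijection of l2, so that the default value 0, which 'pinv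
   takes outside the image of l2, plays no role on l2. *)
Definition resolvent A B z : (int -> 'cV[C]_m) -> (int -> 'cV[C]_m) :=
  'pinv_(fun=> 0) l2 (fun f k => jacobi A B f k - z *: f k).

(* The j-th basis vector of C^m placed at the site l. *)
Definition site_basis (l : int) (j : 'I_m) : int -> 'cV[C]_m :=
  fun k => if k == l then delta_mx j 0 else 0.

Definition green A B z (k l : int) : 'M[C]_m :=
  \matrix_(i, j) resolvent A B z (site_basis l j) k i 0.

Definition diag_green A B z (k : int) : 'M[C]_m := green A B z k k.

End JacobiOperators.

(* Main.v *)
(** At z = iy with y large the resolvent is the Neumann series
    - sum_n z^(-n-1) H^n, so the Green's data determine the moments
    (H^n)(k, l), which are sums over the lattice paths of length n from l to k,
    weighted by the coefficients met on the way.  Increasing n by one widens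
    the window of coefficients that such paths can reach by one coefficient on
    each side, and the newly reached one enters the moment only through
    A(k) ... A(j-1) X A(j-1) ... A(l), with X = B(j) or X = A(j)^2.  Since the
    A's are positive definite, this determines X, and A(j) from A(j)^2.  In
    case (ii) one gets instead A(k0) Y + Y A(k0), and the Sylvester equation
    P Y + Y Q = 0 with P, Q > 0 has only the solution Y = 0. *)

From mathcomp Require Import zify ring lra.
Require Import Defs.

Set Implicit Arguments.
Unset Strict Implicit.
Unset Printing Implicit Defensive.

Import Order.TTheory GRing.Theory Num.Theory.
Import ComplexField.Normc.
Import numFieldNormedType.Exports.
Local Open Scope classical_set_scope.
Local Open Scope ring_scope.
Local Open Scope sesquilinear_scope.

(** * Positive definite matrices *)

Section PositiveDefinite.
Context {R : realType} {m : nat}.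
Local Notation C := R[i].
Implicit Types P Q Y : 'M[C]_m.

Lemma conjtrmxK n1 n2 (X : 'M[C]_(n1, n2)) : (X ^t*) ^t* = X.
Proof.
by rewrite map_trmx trmxK -map_mx_comp map_mx_id// => x /=; exact: conjCK.
Qed.

Lemma posdefmx_ge0 P (v : 'cV[C]_m) : posdefmx P -> 0 <= (v ^t* *m P *m v) 0 0.
Proof.
move=> [_ Ppos]; have [->|/Ppos/ltW//] := eqVneq v 0.
by rewrite mulmx0 mxE.
Qed.

Lemma posdefmx_eq0 P (v : 'cV[C]_m) :
  posdefmx P -> (v ^t* *m P *m v) 0 0 = 0 -> v = 0.
Proof.
move=> [_ Ppos] v0; apply/eqP; apply: contraT => /Ppos.
by rewrite v0 ltxx.
Qed.

Lemma diag_congr n1 n2 (X : 'M[C]_(n1, n2)) (P : 'M[C]_n1) i :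
  (X ^t* *m P *m X) i i = ((col i X) ^t* *m P *m col i X) 0 0.
Proof.
rewrite !mxE; apply: eq_bigr => j _; rewrite !mxE; congr (_ * _).
by apply: eq_bigr => k _; rewrite !mxE.
Qed.

Lemma mxtrace_congr_ge0 P Y : posdefmx P -> 0 <= \tr (Y ^t* *m P *m Y).
Proof.
by move=> Ppos; apply: sumr_ge0 => i _; rewrite diag_congr posdefmx_ge0.
Qed.

Lemma mxtrace_congr_eq0 P Y : posdefmx P -> \tr (Y ^t* *m P *m Y) = 0 -> Y = 0.
Proof.
move=> Ppos /eqP; rewrite psumr_eq0 => [/allP Y0|i _]; last first.
  by rewrite diag_congr posdefmx_ge0.
apply/matrixP => i j; have /eqP := Y0 j (mem_index_enum _).
rewrite diag_congr => /(posdefmx_eq0 Ppos)/matrixP/(_ i 0).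
by rewrite !mxE.
Qed.

(** Multiply the equation by [Y ^t*] on the left and take the trace: both resulting terms are traces
    of congruences, hence nonnegative, so the first one vanishes. *)
Lemma sylvester_eq0 P Q Y :
  posdefmx P -> posdefmx Q -> P *m Y + Y *m Q = 0 -> Y = 0.
Proof.
move=> Ppos Qpos PYQ; apply: (mxtrace_congr_eq0 Ppos); apply/eqP.
have : \tr (Y ^t* *m P *m Y) + \tr ((Y ^t*) ^t* *m Q *m Y ^t*) = 0.
  rewrite conjtrmxK (mxtrace_mulC (Y *m Q)) -mulmxA -raddfD /= -mulmxDr PYQ.
  by rewrite mulmx0 mxtrace0.
move/eqP; rewrite paddr_eq0 ?mxtrace_congr_ge0//.
by case/andP.
Qed.

Lemma posdefmx_unit P : posdefmx P -> P \in unitmx.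
Proof.
move=> Ppos; rewrite -row_free_unit -kermx_eq0; apply/eqP.
apply/row_matrixP => i; rewrite row0.
have : row i (kermx P) *m P = 0 by rewrite -row_mul mulmx_ker row0.
set u := row _ _ => uP.
(* A row [u] of the left kernel has [u *m P = 0], so the quadratic form of [P] vanishes at
   [u ^t*]. *)
have : u ^t* = 0 by apply: (posdefmx_eq0 Ppos); rewrite conjtrmxK uP mul0mx mxE.
by move=> u0; rewrite -(conjtrmxK u) u0 trmx0 map_mx0.
Qed.

(** [P - Q] solves the Sylvester equation [P *m Y + Y *m Q = 0]. *)
Lemma posdefmx_sqr_inj P Q : posdefmx P -> posdefmx Q ->
  P *m P = Q *m Q -> P = Q.
Proof.
move=> Ppos Qpos PQ; apply/eqP; rewrite -subr_eq0; apply/eqP.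
apply: (sylvester_eq0 Ppos Qpos).
by rewrite mulmxBr mulmxBl PQ addrA subrK subrr.
Qed.

End PositiveDefinite.

(** * Moments and their light cone *)

Lemma addrK2 (V : zmodType) (x y u v : V) : x + u + v - (y + u + v) = x - y.
Proof. by rewrite -!(addrA _ u) opprD addrACA subrr addr0. Qed.

Section Moments.
Context {R : realType} {m : nat}.
Local Notation C := R[i].
Implicit Types (A B : int -> 'M[C]_m) (j k l lo hi : int).

(** The [(k, l)] block of the [n]-th power of H, read off columnwise from the formal operator on all
    sequences. *)
Definition moment A B (n : nat) k l : 'M[C]_m :=
  \matrix_(i, j) iter n (jacobi A B) (site_basis l j) k i 0.

Lemma moment0 A B k l : moment A B 0 k l = (k == l)%:R%:M.
Proof.
apply/matrixP => i j; rewrite !mxE /= /site_basis.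
by case: eqP => _; rewrite ?mxE ?andbT// mul0rn.
Qed.

Lemma momentS A B n k l : moment A B n.+1 k l =
  A k *m moment A B n (k + 1) l + A (k - 1) *m moment A B n (k - 1) l
  + B k *m moment A B n k l.
Proof.
apply/matrixP => i j; rewrite !mxE.
by congr (_ + _ + _); apply: eq_bigr => s _; rewrite ?mxE.
Qed.

(** H is block tridiagonal, so its [n]-th power has bandwidth [n]. *)
Lemma moment_far A B n k l :
  n%:Z < k - l \/ n%:Z < l - k -> moment A B n k l = 0.
Proof.
elim: n k => [|n IHn] k far.
  by rewrite moment0; case: eqP => [kl|_]; [lia|rewrite raddf0].
by rewrite momentS !IHn ?mulmx0 ?addr0//; lia.
Qed.

(** Coefficients after the flip of the line at 0: the edge from [k] to [k + 1] becomes the edge from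
    [- k - 1] to [- k], whence the shift for [A] only. *)
Definition reflA A k := A (- k - 1).
Definition reflB B k := B (- k).

Lemma moment_refl A B n k l :
  moment (reflA A) (reflB B) n (- k) (- l) = moment A B n k l.
Proof.
elim: n k => [|n IHn] k; first by rewrite !moment0 eqr_opp.
rewrite !momentS /reflA /reflB !opprK -!IHn.
have -> : - (- k - 1) - 1 = k by lia.
have -> : - k + 1 = - (k - 1) by lia.
have -> : - k - 1 = - (k + 1) by lia.
by congr (_ + _); exact: addrC.
Qed.

(* Site k sits at position 2k, carrying B k, and the edge between k and k + 1
   at position 2k + 1, carrying A k.  A path of length n from l to k sees the
   position p on the right iff p + 1 - l - k <= n, and on the left iff
   k + l - p + 1 <= n. *)
Definition agree A1 B1 A2 B2 lo hi := forall k,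
  (lo < k * 2 < hi -> B1 k = B2 k) /\ (lo < k * 2 + 1 < hi -> A1 k = A2 k).

Lemma agree_refl A1 B1 A2 B2 lo hi : agree A1 B1 A2 B2 lo hi <->
  agree (reflA A1) (reflB B1) (reflA A2) (reflB B2) (- hi) (- lo).
Proof.
split=> agr k; rewrite /reflA /reflB.
- by split=> ?; [apply: (agr _).1|apply: (agr _).2]; lia.
- have [agrB _] := agr (- k); have [_ agrA] := agr (- k - 1).
  split=> [?|?].
  + by move: agrB; rewrite /reflB opprK; apply; lia.
  + move: agrA; rewrite /reflA; have -> : - (- k - 1) - 1 = k by lia.
    by apply; lia.
Qed.

(** * Comparing the moments of two operators that agree on a window *)

Section TwoOperators.
Variables A1 B1 A2 B2 : int -> 'M[C]_m.
Local Notation agree := (agree A1 B1 A2 B2).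
Local Notation M1 := (moment A1 B1).
Local Notation M2 := (moment A2 B2).

Lemma moment_cone lo hi n k l : agree lo hi ->
  n%:Z < hi + 1 - l - k -> n%:Z < k + l - lo + 1 -> M1 n k l = M2 n k l.
Proof.
move=> agr; elim: n k => [|n IHn] k nhi nlo; first by rewrite !moment0.
have far k' : n%:Z < k' - l \/ n%:Z < l - k' -> M2 n k' l = 0.
  exact: moment_far.
rewrite !momentS !IHn; [|lia..].
(* Each coefficient met at the last step either lies in the window or multiplies a moment that
   vanishes by [moment_far]. *)
congr (_ + _ + _).
- have [kw|kw] := boolP (lo < k * 2 + 1 < hi); first by rewrite (agr k).2.
  by rewrite far ?mulmx0//; lia.
- have [kw|kw] := boolP (lo < (k - 1) * 2 + 1 < hi).
    by rewrite (agr (k - 1)).2.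
  by rewrite far ?mulmx0//; lia.
- have [kw|kw] := boolP (lo < k * 2 < hi); first by rewrite (agr k).1.
  by rewrite far ?mulmx0//; lia.
Qed.

(** Weights of the straight paths: [rprod] is A(j-d) ... A(j-1), from [j] down to [j - d]; [lprod]
    is A(j-1) ... A(j-d), from [j - d] up to [j]. *)
Fixpoint rprod A j d : 'M[C]_m :=
  if d is d'.+1 then A (j - d%:Z) *m rprod A j d' else 1%:M.

Fixpoint lprod A j d : 'M[C]_m :=
  if d is d'.+1 then lprod A j d' *m A (j - d%:Z) else 1%:M.

Lemma lprodS A j d : lprod A (j + 1) d.+1 = A j *m lprod A j d.
Proof.
elim: d => [|d IHd]; first by rewrite /= mulmx1 mul1mx addrK.
rewrite -[LHS]/(lprod A (j + 1) d.+1 *m A (j + 1 - d.+2%:Z)) IHd -mulmxA.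
by congr (_ *m (_ *m A _)); lia.
Qed.

Lemma rprod_unit A j d : (forall k, A k \in unitmx) -> rprod A j d \in unitmx.
Proof.
by move=> Au; elim: d => [|d IHd] /=; rewrite ?unitmx1// unitmx_mul Au IHd.
Qed.

Lemma lprod_unit A j d : (forall k, A k \in unitmx) -> lprod A j d \in unitmx.
Proof.
by move=> Au; elim: d => [|d IHd] /=; rewrite ?unitmx1// unitmx_mul Au IHd.
Qed.

(** The straight path is the only one of length [n] between sites at distance [n]. *)
Lemma moment_front A B n l : moment A B n (l + n%:Z) l = lprod A (l + n%:Z) n.
Proof.
elim: n => [|n IHn]; first by rewrite moment0 addr0 eqxx.
have -> : l + n.+1%:Z = l + n%:Z + 1 by lia.
rewrite momentS (moment_far A B (k := l + n%:Z + 1 + 1)); last by lia.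
rewrite (moment_far A B (k := l + n%:Z + 1)); last by lia.
by rewrite !mulmx0 add0r addr0 addrK IHn lprodS.
Qed.

(** [n.+1] is the critical length, at which position [hi] is first seen. After removing the last
    step, only the term at [k + 1] is still critical; the other two are inside the cone. *)
Lemma moment_diff_down lo hi n k l : agree lo hi ->
  n.+1%:Z = hi + 1 - l - k -> n.+1%:Z < k + l - lo + 1 ->
  lo < k * 2 + 1 < hi ->
  M1 n.+1 k l - M2 n.+1 k l = A1 k *m (M1 n (k + 1) l - M2 n (k + 1) l).
Proof.
move=> agr nhi nlo kw; rewrite !momentS.
have cone k' : n%:Z < hi + 1 - l - k' -> n%:Z < k' + l - lo + 1 ->
  M1 n k' l = M2 n k' l by exact: moment_cone agr.
rewrite (cone k) ?(cone (k - 1)); [|lia..].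
have far k' : n%:Z < l - k' -> M2 n k' l = 0.
  by move=> ?; apply: moment_far; right.
have -> : A1 (k - 1) *m M2 n (k - 1) l = A2 (k - 1) *m M2 n (k - 1) l.
  have [?|?] := boolP (lo < (k - 1) * 2 + 1).
    by rewrite (agr (k - 1)).2//; lia.
  by rewrite far ?mulmx0//; lia.
have -> : B1 k *m M2 n k l = B2 k *m M2 n k l.
  have [?|?] := boolP (lo < k * 2); first by rewrite (agr k).1//; lia.
  by rewrite far ?mulmx0//; lia.
by rewrite addrK2 -(agr k).2// mulmxBr.
Qed.

(** A critical path climbs straight from [j - e] to the turning site [j], spends [n0] steps there,
    and descends straight to [j - d]. [n0] is 1 for a loop weighted by [B j], and 2 for crossing the
    edge [A j] and coming back. *)
Lemma moment_diff lo hi j d e (D : 'M[C]_m) n0 : agree lo hi ->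
  j * 2 <= hi -> n0%:Z = hi + 1 - j * 2 ->
  lo + d%:Z * 2 + e%:Z * 2 < j * 4 - hi ->
  M1 (n0 + e) j (j - e%:Z) - M2 (n0 + e) j (j - e%:Z) = D ->
  M1 (d + (n0 + e)) (j - d%:Z) (j - e%:Z) -
    M2 (d + (n0 + e)) (j - d%:Z) (j - e%:Z) = rprod A1 j d *m D.
Proof.
move=> agr jhi n0E dlo DE; elim: d dlo => [|d IHd] dlo.
  by rewrite mul1mx add0n subr0.
rewrite addSn (moment_diff_down agr); [|lia..].
have -> : j - d.+1%:Z + 1 = j - d%:Z by lia.
by rewrite IHd ?mulmxA//; lia.
Qed.

Lemma moment_diffB lo j d e : agree lo (j * 2) ->
  lo + d%:Z * 2 + e%:Z * 2 < j * 2 ->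
  M1 (d + (1 + e)) (j - d%:Z) (j - e%:Z) -
    M2 (d + (1 + e)) (j - d%:Z) (j - e%:Z) =
  rprod A1 j d *m ((B1 j - B2 j) *m lprod A1 j e).
Proof.
move=> agr dlo; apply: (moment_diff agr); [lia|lia|lia|].
rewrite add1n !momentS.
have cone k : j - 1 <= k -> k <= j -> M1 e k (j - e%:Z) = M2 e k (j - e%:Z).
  by move=> ? ?; apply: (moment_cone agr); lia.
rewrite !(fun A B => @moment_far A B _ (j + 1)) ?mulmx0 ?add0r; [|lia..].
rewrite !cone; [|lia..].
have -> : A1 (j - 1) *m M2 e (j - 1) (j - e%:Z) =
    A2 (j - 1) *m M2 e (j - 1) (j - e%:Z).
  have [?|?] := boolP (lo < (j - 1) * 2 + 1).
    by rewrite (agr (j - 1)).2//; lia.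
  by rewrite moment_far ?mulmx0//; lia.
rewrite opprD addrACA subrr add0r -mulmxBl -cone; [|lia..].
(* [subrK] turns [j] into [j - e + e], the shape that [moment_front] expects. *)
by rewrite -[X in moment _ _ _ X](subrK e%:Z) moment_front subrK.
Qed.

Lemma moment_diffA lo j d e : agree lo (j * 2 + 1) ->
  lo + d%:Z * 2 + e%:Z * 2 < j * 2 - 1 ->
  M1 (d + (2 + e)) (j - d%:Z) (j - e%:Z) -
    M2 (d + (2 + e)) (j - d%:Z) (j - e%:Z) =
  rprod A1 j d *m ((A1 j *m A1 j - A2 j *m A2 j) *m lprod A1 j e).
Proof.
move=> agr dlo; apply: (moment_diff agr); [lia|lia|lia|].
rewrite add2n !(momentS _ _ e.+1).
have cone k : j - 1 <= k -> k <= j ->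
    M1 e.+1 k (j - e%:Z) = M2 e.+1 k (j - e%:Z).
  by move=> ? ?; apply: (moment_cone agr); lia.
rewrite (cone j) ?(cone (j - 1)); [|lia..].
have -> : A1 (j - 1) *m M2 e.+1 (j - 1) (j - e%:Z) =
    A2 (j - 1) *m M2 e.+1 (j - 1) (j - e%:Z).
  have [?|?] := boolP (lo < (j - 1) * 2 + 1).
    by rewrite (agr (j - 1)).2//; lia.
  by rewrite moment_far ?mulmx0//; lia.
rewrite (agr j).1; last by lia.
rewrite addrK2.
(* At [j + 1] only the step from [j] survives: [e] steps from [j - e] reach neither [j + 1] nor
   [j + 2], so the unknown coefficients there drop out. *)
rewrite !momentS !addrK !(fun A B => @moment_far A B _ (j + 1)); [|lia..].
rewrite !(fun A B => @moment_far A B _ (j + 1 + 1)); [|lia..].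
rewrite !mulmx0 !add0r !addr0.
have <- : M1 e j (j - e%:Z) = M2 e j (j - e%:Z) by apply: (moment_cone agr); lia.
rewrite !mulmxA -mulmxBl.
by rewrite -[X in moment _ _ _ X](subrK e%:Z) moment_front subrK.
Qed.

End TwoOperators.

(** * Extending the window by one coefficient on the right *)

Section Determination.
Variables A1 B1 A2 B2 : int -> 'M[C]_m.
Hypotheses (A1pos : forall k, posdefmx (A1 k))
  (A2pos : forall k, posdefmx (A2 k)).
Local Notation agree := (agree A1 B1 A2 B2).
Local Notation M1 := (moment A1 B1).
Local Notation M2 := (moment A2 B2).

Let A1u k : A1 k \in unitmx. Proof. exact: posdefmx_unit. Qed.

Lemma sandwich_eq0 (W V D : 'M[C]_m) : W \in unitmx -> V \in unitmx ->
  W *m (D *m V) = 0 -> D = 0.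
Proof.
move=> Wu Vu /(congr1 (mulmx (invmx W))); rewrite mulKmx// mulmx0.
by move=> /(congr1 (mulmxr (invmx V))) /=; rewrite mulmxK// mul0mx.
Qed.

(** The only new position is [hi], and its parity tells whether a [B] or an [A] sits there; for an
    [A] the square suffices. *)
Lemma agree_extend_right lo hi : agree lo hi ->
  (forall j, hi = j * 2 -> B1 j = B2 j) ->
  (forall j, hi = j * 2 + 1 -> A1 j *m A1 j = A2 j *m A2 j) ->
  agree lo (hi + 1).
Proof.
move=> agr eqB eqA k; split=> kw.
- have [?|?] := boolP (k * 2 < hi); first by apply: (agr k).1; lia.
  by apply: eqB; lia.
- have [?|?] := boolP (k * 2 + 1 < hi); first by apply: (agr k).2; lia.
  by apply: posdefmx_sqr_inj => //; apply: eqA; lia.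
Qed.

Lemma agree_right lo hi n k l : agree lo hi ->
  k * 2 <= hi -> l * 2 <= hi ->
  n%:Z = hi + 1 - l - k -> n%:Z < k + l - lo + 1 ->
  M1 n k l = M2 n k l -> agree lo (hi + 1).
Proof.
move=> agr khi lhi nhi nlo M12; apply: agree_extend_right => // j hiE; subst hi.
(* [d] and [e] are the distances from [k] and [l] to the turning site [j]; the invertible straight
   weights are then cancelled on both sides. *)
- have [d dE] : exists d : nat, d%:Z = j - k by exists `|j - k|%N; lia.
  have [e eE] : exists e : nat, e%:Z = j - l by exists `|j - l|%N; lia.
  have := @moment_diffB A1 B1 A2 B2 lo j d e agr ltac:(lia).
  have -> : (d + (1 + e))%N = n by lia.
  have -> : j - d%:Z = k by lia.
  have -> : j - e%:Z = l by lia.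
  rewrite M12 subrr => /esym/sandwich_eq0 D0.
  by apply/eqP; rewrite -subr_eq0 D0// ?rprod_unit ?lprod_unit.
- have [d dE] : exists d : nat, d%:Z = j - k by exists `|j - k|%N; lia.
  have [e eE] : exists e : nat, e%:Z = j - l by exists `|j - l|%N; lia.
  have := @moment_diffA A1 B1 A2 B2 lo j d e agr ltac:(lia).
  have -> : (d + (2 + e))%N = n by lia.
  have -> : j - d%:Z = k by lia.
  have -> : j - e%:Z = l by lia.
  rewrite M12 subrr => /esym/sandwich_eq0 D0.
  by apply/eqP; rewrite -subr_eq0 D0// ?rprod_unit ?lprod_unit.
Qed.

(** [X] and [Y] stand for the moments at [(k, k + 1)] and [(k + 1, k)], with [P] the extra factor
    [A1 k]. Equal sums give a Sylvester equation for [W *m (D *m V)]. *)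
Lemma sylvester_diff_eq0 (P W V D X1 X2 Y1 Y2 : 'M[C]_m) : posdefmx P ->
  W \in unitmx -> V \in unitmx ->
  X1 + Y1 = X2 + Y2 -> X1 - X2 = P *m W *m (D *m V) ->
  Y1 - Y2 = W *m (D *m (V *m P)) -> D = 0.
Proof.
move=> Ppos Wu Vu XY XE YE; apply: (sandwich_eq0 Wu Vu).
apply: (sylvester_eq0 Ppos Ppos).
rewrite -!mulmxA in XE YE *; rewrite -XE -YE addrACA -opprD.
by rewrite XY subrr.
Qed.

Lemma agree_right_sum lo hi n k : agree lo hi ->
  k * 2 + 2 <= hi -> n%:Z = hi - k * 2 -> n%:Z < k * 2 + 2 - lo ->
  M1 n k (k + 1) + M1 n (k + 1) k = M2 n k (k + 1) + M2 n (k + 1) k ->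
  agree lo (hi + 1).
Proof.
move=> agr khi nhi nlo M12.
apply: agree_extend_right => // j hiE; subst hi.
(* [e] is the distance from [k + 1] to the turning site. At distance [e.+1], the products split off
   the factor [A1 k], on the left in [rprod] and on the right in [lprod]. *)
all: have [e eE] : exists e : nat, e%:Z = j - k - 1
  by exists (absz (j - k - 1)%R); lia.
all: have jk : j - e.+1%:Z = k by lia.
all: have jk1 : j - e%:Z = k + 1 by lia.
all: apply/eqP; rewrite -subr_eq0; apply/eqP.
all: apply: (@sylvester_diff_eq0 _ (rprod A1 j e) (lprod A1 j e)
  _ _ _ _ _ (A1pos k) _ _ M12).
all: rewrite ?rprod_unit ?lprod_unit//.
- have := @moment_diffB A1 B1 A2 B2 lo j e.+1 e agr ltac:(lia).
  rewrite jk jk1 /= jk; have -> : (e.+1 + (1 + e))%N = n by lia.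
  by [].
- have := @moment_diffB A1 B1 A2 B2 lo j e e.+1 agr ltac:(lia).
  rewrite jk jk1 /= jk; have -> : (e + (1 + e.+1))%N = n by lia.
  by [].
- have := @moment_diffA A1 B1 A2 B2 lo j e.+1 e agr ltac:(lia).
  rewrite jk jk1 /= jk; have -> : (e.+1 + (2 + e))%N = n by lia.
  by [].
- have := @moment_diffA A1 B1 A2 B2 lo j e e.+1 agr ltac:(lia).
  rewrite jk jk1 /= jk; have -> : (e + (2 + e.+1))%N = n by lia.
  by [].
Qed.

End Determination.

(** * Growing the window to the whole line *)

Section Uniqueness.
Variables A1 B1 A2 B2 : int -> 'M[C]_m.
Hypotheses (A1pos : forall k, posdefmx (A1 k))
  (A2pos : forall k, posdefmx (A2 k)).
Local Notation agree := (agree A1 B1 A2 B2).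
Local Notation M1 := (moment A1 B1).
Local Notation M2 := (moment A2 B2).

Lemma agree_left lo hi n k l : agree lo hi -> lo <= k * 2 -> lo <= l * 2 ->
  n%:Z = k + l - lo + 1 -> n%:Z < hi + 1 - l - k ->
  M1 n k l = M2 n k l -> agree (lo - 1) hi.
Proof.
move=> /agree_refl agr klo llo nlo nhi M12; apply/agree_refl.
have -> : - (lo - 1) = - lo + 1 by lia.
have rpos A : (forall k', posdefmx (A k')) -> forall k', posdefmx (reflA A k').
  by move=> Apos k'; exact: Apos.
apply: (agree_right (rpos _ A1pos) (rpos _ A2pos)
  (n := n) (k := - k) (l := - l) agr); [lia..|].
by rewrite !moment_refl.
Qed.

Lemma agree_all c : (forall n : nat, exists lo hi,
  [/\ agree lo hi, lo <= c - n%:Z & c + n%:Z <= hi]) -> A1 = A2 /\ B1 = B2.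
Proof.
move=> agr; split; apply: funext => k.
- have [lo [hi [agrk lo_le le_hi]]] := agr (absz (k * 2 + 1 - c)%R).+1.
  by apply: (agrk k).2; lia.
- have [lo [hi [agrk lo_le le_hi]]] := agr (absz (k * 2 - c)%R).+1.
  by apply: (agrk k).1; lia.
Qed.

Lemma moment1_diag A B k : moment A B 1 k k = B k :> 'M[C]_m.
Proof.
rewrite momentS !moment0 eqxx mulmx1.
have -> : (k + 1 == k) = false by lia.
have -> : (k - 1 == k) = false by lia.
by rewrite raddf0 !mulmx0 !add0r.
Qed.

Lemma moment1_right A B k : moment A B 1 k (k + 1) = A k :> 'M[C]_m.
Proof.
rewrite momentS !moment0 eqxx mulmx1.
have -> : (k == k + 1) = false by lia.
have -> : (k - 1 == k + 1) = false by lia.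
by rewrite raddf0 !mulmx0 !addr0.
Qed.

Lemma moment1_left A B k : moment A B 1 (k + 1) k = A k :> 'M[C]_m.
Proof.
rewrite momentS !moment0 addrK eqxx mulmx1.
have -> : (k + 1 + 1 == k) = false by lia.
have -> : (k + 1 == k) = false by lia.
by rewrite raddf0 !mulmx0 add0r addr0.
Qed.

Section Center.
Variable c : int.
Hypothesis diag_eq : forall n, M1 n c c = M2 n c c.

(** Left and right extensions alternate: a diagonal moment at [c] reaches equally far on both sides,
    so once the right end is one ahead its only unknown is on the left. *)
Lemma agree_sym_window :
  A1 c = A2 c ->
  (forall n : nat, (1 < n)%N -> agree (c * 2 - n%:Z) (c * 2 + n%:Z) ->
     agree (c * 2 - n%:Z) (c * 2 + n%:Z + 1)) ->
  A1 = A2 /\ B1 = B2.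
Proof.
move=> Ac step; have Bc := diag_eq 1; rewrite !moment1_diag in Bc.
(* This window holds just [B c], the moment of length 1, and [A c]. *)
have window0 : agree (c * 2 - 1%:Z) (c * 2 + 1%:Z + 1).
  by move=> k; split=> kw; have -> : k = c by lia.
suff window n : agree (c * 2 - n.+2%:Z) (c * 2 + n.+2%:Z).
  apply: (@agree_all (c * 2)) => n.
  by exists (c * 2 - n.+2%:Z), (c * 2 + n.+2%:Z); split; [exact: window|lia|lia].
have extend i : agree (c * 2 - i%:Z) (c * 2 + i%:Z + 1) ->
    agree (c * 2 - i.+1%:Z) (c * 2 + i.+1%:Z).
  move=> agr; have -> : c * 2 + i.+1%:Z = c * 2 + i%:Z + 1 by lia.
  have -> : c * 2 - i.+1%:Z = c * 2 - i%:Z - 1 by lia.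
  by apply: (agree_left (n := i.+1) (k := c) (l := c) agr); [lia..|].
elim: n => [|n IHn]; apply: extend; first exact: window0.
exact: step.
Qed.

(** The cone of [(c, c + 1)] is centred at position 2c + 1, so in a window centred at 2c it meets
    the right end first. *)
Lemma moments_determine_i : (forall n, M1 n c (c + 1) = M2 n c (c + 1)) ->
  A1 = A2 /\ B1 = B2.
Proof.
move=> off_eq; apply: agree_sym_window => [|n n1 agr].
  by have := off_eq 1; rewrite !moment1_right.
by apply: (agree_right A1pos A2pos (n := n) (k := c) (l := c + 1) agr); [lia..|].
Qed.

Lemma moments_determine_ii :
  (forall n, M1 n c (c + 1) + M1 n (c + 1) c =
             M2 n c (c + 1) + M2 n (c + 1) c) ->
  A1 = A2 /\ B1 = B2.
Proof.
move=> sum_eq; apply: agree_sym_window => [|n n1 agr].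
  (* The sum of the two moments of length 1 is twice [A c]. *)
  have := sum_eq 1; rewrite !moment1_right !moment1_left => /matrixP A12.
  apply/matrixP => i j; have := A12 i j; rewrite !mxE -!mulr2n => /eqP.
  by rewrite -subr_eq0 -mulrnBl mulrn_eq0 subr_eq0 => /eqP.
by apply: (agree_right_sum A1pos A2pos (n := n) (k := c) agr); [lia..|].
Qed.

(** The window is centred at the edge [A c] and starts with [B c], [A c], [B (c + 1)]; site [c + 1]
    extends it to the right, site [c] to the left. *)
Lemma moments_determine_iii :
  (forall n, M1 n (c + 1) (c + 1) = M2 n (c + 1) (c + 1)) ->
  A1 c = A2 c -> A1 = A2 /\ B1 = B2.
Proof.
move=> diag1_eq Ac; have Bc := diag_eq 1; have Bc1 := diag1_eq 1.
rewrite !moment1_diag in Bc Bc1.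
suff window n : agree (c * 2 - n.+1%:Z) (c * 2 + 2 + n.+1%:Z).
  apply: (@agree_all (c * 2)) => n.
  exists (c * 2 - n.+1%:Z), (c * 2 + 2 + n.+1%:Z).
  by split; [exact: window|lia|lia].
elim: n => [|n IHn].
  move=> k; split=> kw; last by have -> : k = c by lia.
  have [->//|/eqP ?] := eqVneq k c.
  by have -> : k = c + 1 by lia.
have -> : c * 2 + 2 + n.+2%:Z = c * 2 + 2 + n.+1%:Z + 1 by lia.
have -> : c * 2 - n.+2%:Z = c * 2 - n.+1%:Z - 1 by lia.
apply: (agree_left (n := n.+2) (k := c) (l := c)); [|lia..|exact: diag_eq].
by apply: (agree_right A1pos A2pos
  (n := n.+2) (k := c + 1) (l := c + 1) IHn); [lia..|].
Qed.

End Center.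
End Uniqueness.
End Moments.

(** * The resolvent at large spectral parameter *)

Section ComplexModulus.
Context {R : realType}.
Local Notation C := R[i].
Implicit Types (z w : C).

Lemma normc_ge0 z : 0 <= normc z.
Proof. by case: z => a b; exact: sqrtr_ge0. Qed.

Lemma normcD_le z w : normc (z + w) <= normc z + normc w.
Proof. exact: le_normcD. Qed.

Lemma normc_opp z : normc (- z) = normc z.
Proof. exact: normcN. Qed.

Lemma normcB_le z w : normc (z - w) <= normc z + normc w.
Proof. by rewrite -(normc_opp w) normcD_le. Qed.

Lemma normcX z n : normc (z ^+ n) = normc z ^+ n.
Proof.
by elim: n => [|n IHn]; rewrite ?normc1// !exprS normcM IHn.
Qed.

Lemma normc_sum (I : Type) (r : seq I) (P : pred I) (F : I -> C) :
  normc (\sum_(i <- r | P i) F i) <= \sum_(i <- r | P i) normc (F i).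
Proof. exact: (@ler_norm_sum _ (Rcomplex R)). Qed.

Lemma normc_le_ReIm z : normc z <= `|complex.Re z| + `|complex.Im z|.
Proof.
case: z => a b /=.
rewrite -[leRHS]ger0_norm ?addr_ge0// -sqrtr_sqr ler_wsqrtr//.
rewrite sqrrD !real_normK ?num_real//.
by have := mulr_ge0 (normr_ge0 a) (normr_ge0 b); lra.
Qed.

Lemma normc_ge_Re z : `|complex.Re z| <= normc z.
Proof. by case: z => a b /=; rewrite -sqrtr_sqr ler_wsqrtr// lerDl sqr_ge0. Qed.

Lemma normc_ge_Im z : `|complex.Im z| <= normc z.
Proof. by case: z => a b /=; rewrite -sqrtr_sqr ler_wsqrtr// lerDr sqr_ge0. Qed.

(* The sum is the supremum of the lower ends of the nested intervals
   [s_N - t_N, s_N + t_N], where t_N bounds the N-th tail. *)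
Lemma real_series_tail (r : nat -> R) (M q : R) :
  0 <= M -> 0 <= q -> q < 1 -> (forall n, `|r n| <= M * q ^+ n) ->
  exists s, forall N, `|s - \sum_(n < N) r n| <= M * q ^+ N / (1 - q).
Proof.
move=> M0 q0 q1 rM; pose S N := \sum_(n < N) r n.
pose t N := M * q ^+ N / (1 - q).
have q1' : 1 - q != 0 by lra.
have tS N : t N.+1 = t N - M * q ^+ N by rewrite /t exprS; field.
have SS N : S N.+1 = S N + r N by rewrite /S big_ord_recr.
have t0 N : 0 <= t N by rewrite /t divr_ge0 ?mulr_ge0 ?exprn_ge0//; lra.
(* [t N - t N.+1] is exactly the bound on [r N], so the intervals are nested. *)
have step N d : S N - t N <= S (N + d)%N - t (N + d)%N /\
    S (N + d)%N + t (N + d)%N <= S N + t N.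
  elim: d => [|d [IH1 IH2]]; first by rewrite addn0.
  have := rM (N + d)%N; rewrite addnS SS tS ler_norml => /andP[? ?].
  by split; lra.
have nested N N' : S N - t N <= S N' + t N'.
  case: (leqP N N') => [/subnKC <-|/ltnW/subnKC <-].
    by have [? _] := step N (N' - N)%N; have := t0 (N + (N' - N))%N; lra.
  by have [_ ?] := step N' (N - N')%N; have := t0 (N' + (N - N'))%N; lra.
pose E := [set S N - t N | N in [set: nat]].
exists (sup E) => N; rewrite -/(S N) -/(t N) ler_norml; apply/andP; split.
  suff : S N - t N <= sup E by lra.
  apply: ub_le_sup; last by exists N.
  by exists (S 0%N + t 0%N) => _ [N' _ <-].
suff : sup E <= S N + t N by lra.
by apply: ge_sup; [exists (S 0%N - t 0%N), 0%N|move=> _ [N' _ <-]].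
Qed.

Lemma complex_series_tail (a : nat -> C) (M q : R) :
  0 <= M -> 0 <= q -> q < 1 -> (forall n, normc (a n) <= M * q ^+ n) ->
  exists s, forall N, normc (s - \sum_(n < N) a n) <= 2 * (M * q ^+ N / (1 - q)).
Proof.
move=> M0 q0 q1 aM.
have [x xP] := real_series_tail M0 q0 q1
  (fun n => le_trans (normc_ge_Re (a n)) (aM n)).
have [y yP] := real_series_tail M0 q0 q1
  (fun n => le_trans (normc_ge_Im (a n)) (aM n)).
exists (Complex x y) => N; apply: (le_trans (normc_le_ReIm _)).
have -> : complex.Re (Complex x y - \sum_(n < N) a n) =
    x - \sum_(n < N) complex.Re (a n).
  by rewrite (raddfB (@complex.Re R : Rcomplex R -> R))
    (raddf_sum (@complex.Re R : Rcomplex R -> R)).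
have -> : complex.Im (Complex x y - \sum_(n < N) a n) =
    y - \sum_(n < N) complex.Im (a n).
  by rewrite (raddfB (@complex.Im R : Rcomplex R -> R))
    (raddf_sum (@complex.Im R : Rcomplex R -> R)).
by have := xP N; have := yP N; lra.
Qed.

End ComplexModulus.

(** * Sup-norm bounds for the Jacobi operator *)

Section BoundedCoefficients.
Context {R : realType} {m : nat}.
Local Notation C := R[i].
Implicit Types (P : 'M[C]_m) (v : 'cV[C]_m).

Lemma normc_le_cnorm v i : normc (v i 0) <= cnorm v.
Proof.
rewrite -[leLHS]ger0_norm ?normc_ge0// -sqrtr_sqr ler_wsqrtr//.
by rewrite (bigD1 i)//= lerDl sumr_ge0// => j _; rewrite sqr_ge0.
Qed.

Lemma cnorm_sqr v : cnorm v ^+ 2 = \sum_i normc (v i 0) ^+ 2.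
Proof. by rewrite sqr_sqrtr// sumr_ge0// => i _; rewrite sqr_ge0. Qed.

Lemma normc_entry_le_opnorm P i j : normc (P i j) <= opnorm P.
Proof.
have -> : P i j = (P *m (delta_mx j 0 : 'cV[C]_m)) i 0.
  by rewrite -colE mxE.
apply: (le_trans (normc_le_cnorm _ _)); apply: ub_le_sup; last first.
  exists (delta_mx j 0) => //=.
  rewrite /cnorm (bigD1 j)//= big1 => [|k /negPf kj].
    by rewrite mxE !eqxx normc1 expr1n addr0 sqrtr1.
  by rewrite mxE kj normc0 expr0n.
(* An upper bound of the set defining [opnorm]: entries of [v] have modulus at most 1 on the unit
   ball. *)
exists (Num.sqrt (\sum_i (\sum_j normc (P i j)) ^+ 2)) => _ [v v1 <-].
rewrite ler_wsqrtr// ler_sum// => k _; rewrite lerXn2r// ?nnegrE ?normc_ge0//.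
  by rewrite sumr_ge0// => l _; rewrite normc_ge0.
rewrite mxE; apply: (le_trans (normc_sum _ _ _)); apply: ler_sum => l _.
by rewrite normcM ler_piMr ?normc_ge0// (le_trans (normc_le_cnorm _ _) v1).
Qed.

Definition bounded_seq (f : int -> 'cV[C]_m) (M : R) :=
  forall k i, normc (f k i 0) <= M.

(** [K] bounds H in the entrywise sup norm rather than in [l2]; all estimates on the resolvent run
    in this norm. *)
Definition bounded_jacobi A B (K : R) := forall f M, 0 <= M ->
  bounded_seq f M -> bounded_seq (jacobi A B f) (K * M).

Lemma bounded_jacobi_le A B K K' :
  K <= K' -> bounded_jacobi A B K -> bounded_jacobi A B K'.
Proof.
move=> KK' bdd f M M0 fM k i; apply: (le_trans (bdd f M M0 fM k i)).
exact: ler_wpM2r.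
Qed.

Lemma normc_mulmx_le P v (c M : R) :
  0 <= M -> (forall i j, normc (P i j) <= c) ->
  (forall i, normc (v i 0) <= M) ->
  forall i, normc ((P *m v) i 0) <= m%:R * c * M.
Proof.
move=> M0 Pc vM i; rewrite mxE; apply: (le_trans (normc_sum _ _ _)).
have -> : m%:R * c * M = \sum_(j < m) c * M.
  by rewrite sumr_const card_ord -[RHS]mulr_natl mulrA.
by apply: ler_sum => j _; rewrite normcM ler_pM ?normc_ge0.
Qed.

Lemma jacobi_coefficients_bounded (A B : int -> 'M[C]_m) :
  jacobi_coefficients A B -> exists K, 0 < K /\ bounded_jacobi A B K.
Proof.
case=> _ _ [c [c0 ABc]].
have opnorm_ge0 P : 0 <= opnorm P.
  have [[ubP]|/sup_out noub] := pselect (has_sup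
      [set cnorm (P *m v) | v in [set v : 'cV[C]_m | cnorm v <= 1]]).
    move=> hub; apply: (@le_trans _ _ (cnorm (P *m 0))); first exact: sqrtr_ge0.
    apply: ub_le_sup => //; exists 0 => //=.
    rewrite /cnorm big1 ?sqrtr0// => i _.
    by rewrite mxE normc0 expr0n.
  (* Without a supremum, [sup] takes the value 0. *)
  by rewrite /opnorm noub.
have Ac k i j : normc (A k i j) <= c.
  rewrite (le_trans (normc_entry_le_opnorm _ _ _))//.
  by rewrite (le_trans _ (ABc k))// lerDl.
have Bc k i j : normc (B k i j) <= c.
  rewrite (le_trans (normc_entry_le_opnorm _ _ _))//.
  by rewrite (le_trans _ (ABc k))// lerDr.
exists (3 * (m%:R * c) + 1); split; first by rewrite ltr_wpDl// !mulr_ge0// ltW.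
move=> f M M0 fM k i; rewrite /jacobi mxE [X in normc (X + _)]mxE.
apply: (le_trans (normcD_le _ _)).
apply: (le_trans (lerD (normcD_le _ _) (lexx _))).
have Af k' k'' := normc_mulmx_le M0 (Ac k') (fM k'') i.
have Bf := normc_mulmx_le M0 (Bc k) (fM k) i.
by have := Af k (k + 1); have := Af (k - 1) (k - 1); lra.
Qed.

Lemma jacobiD A B a f g k :
  jacobi A B (fun k => a *: f k + g k) k =
  a *: jacobi A B f k + jacobi A B g k :> 'cV[C]_m.
Proof.
rewrite /jacobi !mulmxDr -!scalemxAr !scalerDr.
by rewrite [X in X + _ = _]addrACA [LHS]addrACA.
Qed.

Lemma jacobi0 A B k : jacobi A B (fun=> 0) k = 0 :> 'cV[C]_m.
Proof. by rewrite /jacobi !mulmx0 !addr0. Qed.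

Lemma iter_jacobiD A B a f g n :
  iter n (jacobi A B) (fun k => a *: f k + g k) =
  (fun k => a *: iter n (jacobi A B) f k + iter n (jacobi A B) g k)
  :> (int -> 'cV[C]_m).
Proof.
elim: n => [|n IHn]//; rewrite !iterS IHn.
by apply: funext => k; rewrite jacobiD.
Qed.

Lemma iter_jacobi_bounded A B K f M n :
  0 <= K -> 0 <= M -> bounded_jacobi A B K ->
  bounded_seq f M -> bounded_seq (iter n (jacobi A B) f) (K ^+ n * M).
Proof.
move=> K0 M0 bdd fM; elim: n => [|n IHn]; first by rewrite expr0 mul1r.
by rewrite iterS exprS -mulrA; apply: bdd => //; rewrite mulr_ge0 ?exprn_ge0.
Qed.

Lemma iter_jacobi_far A B n k l j :
  n%:Z < k - l \/ n%:Z < l - k ->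
  iter n (jacobi A B) (site_basis l j) k = 0 :> 'cV[C]_m.
Proof.
elim: n k => [|n IHn] k far.
  by rewrite /= /site_basis; case: eqP => //; lia.
by rewrite iterS /jacobi !IHn ?mulmx0 ?addr0//; lia.
Qed.

Lemma site_basis_bounded l j : bounded_seq (@site_basis R m l j) 1.
Proof.
move=> k i; rewrite /site_basis.
case: eqP => _; rewrite mxE; last by rewrite normc0.
by case: (_ && _); rewrite ?normc0 ?normc1.
Qed.

End BoundedCoefficients.

(** * Square summability of geometrically decaying sequences *)

Lemma set_bij_ge l :
  set_bij [set: nat] [set k : int | l <= k] (fun n => l + n%:Z).
Proof.
split=> [n _ /=|n n' _ _ /= nn'|k /= lk]; [by lia|by lia|].
by exists `|k - l|%N => //; lia.
Qed.

Lemma set_bij_lt l :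
  set_bij [set: nat] (~` [set k : int | l <= k]) (fun n => l - n.+1%:Z).
Proof.
split=> [n _ /=|n n' _ _ /= nn'|k /= lk]; [by lia|by lia|].
by exists `|k - l|.-1%N => //; lia.
Qed.

Lemma distn_ge (l : int) n : `|(l + n%:Z)%R - l|%N = n. Proof. by lia. Qed.

Lemma distn_lt (l : int) n : `|(l - n.+1%:Z)%R - l|%N = n.+1. Proof. by lia. Qed.

Section SquareSummable.
Context {R : realType} {m : nat}.
Local Notation C := R[i].

Lemma geometric_l2 (f : int -> 'cV[C]_m) (l : int) (D' q' : R) :
  0 <= q' -> q' < 1 ->
  (forall k i, normc (f k i 0) <= D' * q' ^+ `|k - l|%N) -> l2 f.
Proof.
move=> q'0 q'1 fle.
pose p := q' ^+ 2; pose c := m%:R * D' ^+ 2.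
have p0 : 0 <= p by exact: sqr_ge0.
have p1 : p < 1 by rewrite /p expr_lt1.
have c0 : 0 <= c by rewrite mulr_ge0// sqr_ge0.
have fle2 k : cnorm (f k) ^+ 2 <= c * p ^+ `|k - l|%N.
  rewrite cnorm_sqr.
  have -> : c * p ^+ `|k - l|%N = \sum_(i < m) (D' * q' ^+ `|k - l|%N) ^+ 2.
    rewrite sumr_const card_ord -[RHS]mulr_natl /c /p.
    by rewrite -exprM mulnC exprM -mulrA -exprMn.
  apply: ler_sum => i _; rewrite lerXn2r// nnegrE ?normc_ge0//.
  exact: le_trans (normc_ge0 _) (fle k i).
have geo n : \sum_(i < n) c * p ^+ i <= c / (1 - p).
  rewrite -mulr_sumr ler_wpM2l// -[leRHS]div1r ler_pdivlMr ?subr_gt0//.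
  have := subrX1 p n; have := exprn_ge0 n p0; lra.
(* The two half-lines on either side of [l] give the exponents [n] and [n.+1]; this bound serves
   both. *)
have geoE (e : nat -> nat) : (forall n, (n <= e n)%N) ->
    (\esum_(n in [set: nat]) (c * p ^+ e n)%:E < +oo)%E.
  move=> ne; have t0 n : (0 <= (c * p ^+ e n)%:E)%E.
    by rewrite lee_fin mulr_ge0// exprn_ge0.
  rewrite -nneseries_esumT//.
  apply: (@le_lt_trans _ _ (c / (1 - p))%:E); last exact: ltry.
  apply: lime_le; first by apply: is_cvg_nneseries.
  apply: nearW => n; rewrite sumEFin lee_fin big_mkord.
  apply: le_trans (geo n); apply: ler_sum => i _; rewrite ler_wpM2l//.
  by rewrite ler_wiXn2l// ltW.
rewrite /l2 /=.
apply: (@le_lt_trans _ _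
  (\esum_(k in [set: int]) (c * p ^+ `|k - l|%N)%:E)%E).
  by apply: le_esum => k _; rewrite lee_fin.
rewrite (esumID [set k | l <= k]) => [|k _]; last first.
  by rewrite lee_fin mulr_ge0// exprn_ge0.
rewrite !setTI; apply: lte_add_pinfty.
- rewrite (reindex_esum _ _ _ _ (set_bij_ge l)).
  rewrite (eq_esum (b := fun n => (c * p ^+ n)%:E)); first exact: (geoE id).
  by move=> n _; rewrite distn_ge.
- rewrite (reindex_esum _ _ _ _ (set_bij_lt l)).
  rewrite (eq_esum (b := fun n => (c * p ^+ n.+1)%:E)); first exact: (geoE S).
  by move=> n _; rewrite distn_lt.
Qed.

Lemma l2_bounded (f : int -> 'cV[C]_m) : l2 f -> exists M, bounded_seq f M.
Proof.
rewrite /l2 /=; set s := (\esum_(_ in _) _)%E => soo.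
have s0 : (0 <= s)%E by apply: esum_ge0 => k _; rewrite lee_fin sqr_ge0.
have sfin : s \is a fin_num by rewrite ge0_fin_numE.
exists (Num.sqrt (fine s)) => k i; apply: (le_trans (normc_le_cnorm _ _)).
rewrite -[leLHS]ger0_norm ?sqrtr_ge0// -sqrtr_sqr ler_wsqrtr//.
rewrite -lee_fin fineK//; apply: esum_ge; exists [set k]; first by split.
by rewrite fsbig_set1.
Qed.

End SquareSummable.

(** * Neumann series and resolvent for [z] outside the disc of radius [K] *)

Section Resolvent.
Context {R : realType} {m : nat}.
Local Notation C := R[i].
Variables (A B : int -> 'M[C]_m) (K : R).
Hypotheses (K0 : 0 <= K) (bdd : bounded_jacobi A B K).
Variables (z : C) (l : int) (j : 'I_m).
Hypothesis Kz : K < normc z.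
Local Notation F n := (iter n (jacobi A B) (site_basis l j)).

Let nz0 : 0 < normc z. Proof. exact: le_lt_trans Kz. Qed.
Let z0 : z != 0. Proof. by apply: contraTneq nz0 => ->; rewrite normc0 ltxx. Qed.

Let q := K / normc z.
Let q0 : 0 <= q. Proof. by rewrite divr_ge0// ltW. Qed.
Let q1 : q < 1. Proof. by rewrite ltr_pdivrMr// mul1r. Qed.

Definition neumann N k : 'cV[C]_m := \sum_(n < N) - z ^- n.+1 *: F n k.

Lemma neumannS N : neumann N.+1 = fun k => - z ^- N.+1 *: F N k + neumann N k.
Proof. by apply: funext => k; rewrite /neumann big_ord_recr addrC. Qed.

(** Applying H - z telescopes the sum. *)
Lemma neumann_residual N k :
  jacobi A B (neumann N) k - z *: neumann N k =
  site_basis l j k - z ^- N *: F N k.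
Proof.
elim: N => [|N IHN].
  have -> : neumann 0 = fun=> 0.
    by apply: funext => k'; rewrite /neumann big_ord0.
  by rewrite jacobi0 scaler0 expr0 invr1 scale1r !subrr.
have zV : z * z ^- N.+1 = z ^- N by rewrite exprS invfM mulVKf.
rewrite neumannS jacobiD; cbv beta.
rewrite [X in _ - X]scalerDr opprD addrACA IHN -iterS.
rewrite !scaleNr scalerN opprK scalerA zV.
by rewrite addrC [- _ + _]addrC addrA subrK.
Qed.

Lemma neumann_term_bound n k i :
  normc ((- z ^- n.+1 *: F n k) i 0) <= (normc z)^-1 * q ^+ n.
Proof.
rewrite mxE normcM normc_opp normcV normcX exprS invfM -mulrA.
rewrite ler_wpM2l ?invr_ge0 ?normc_ge0// /q expr_div_n mulrC.
rewrite ler_wpM2r ?invr_ge0 ?exprn_ge0 ?normc_ge0//.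
have := iter_jacobi_bounded n K0 ler01 bdd (@site_basis_bounded R m l j) k i.
by rewrite mulr1.
Qed.

Let D := 2 * ((normc z)^-1 / (1 - q)).
Let D0 : 0 <= D.
Proof.
by rewrite /D mulr_ge0// divr_ge0 ?invr_ge0 ?normc_ge0// subr_ge0 ltW.
Qed.

Lemma neumann_converges : exists f : int -> 'cV[C]_m, forall N,
  bounded_seq (fun k => f k - neumann N k) (D * q ^+ N).
Proof.
have lim k i : exists s, forall N,
    normc (s - neumann N k i 0) <= D * q ^+ N.
  have V0 : 0 <= (normc z)^-1 by rewrite invr_ge0 normc_ge0.
  have [s sP] := complex_series_tail V0 q0 q1
    (fun n => neumann_term_bound n k i).
  exists s => N; rewrite /neumann summxE; apply: (le_trans (sP N)).
  have -> // : D * q ^+ N = 2 * ((normc z)^-1 * q ^+ N / (1 - q)).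
  by rewrite /D -mulrA [_ / _ * _]mulrAC.
exists (fun k => \col_i projT1 (cid (lim k i))) => N k i.
by rewrite !mxE; case: (cid _) => s /= /(_ N).
Qed.

Lemma le0_geometric (x : R) (c : R) : (forall N, x <= c * q ^+ N) -> x <= 0.
Proof.
move=> xc; have /cvgrPdist_lt cv : geometric c q @ \oo --> (0 : R).
  by apply: cvg_geometric; rewrite ger0_norm.
rewrite leNgt; apply/negP => x0.
have [N _ /(_ N (leqnn N))] := cv x x0.
have := xc N => /[swap]; rewrite /geometric /= sub0r normrN.
by move=> /(le_lt_trans (ler_norm _)) /lt_geF ->.
Qed.

Lemma resolvent_equation_solvable : exists f : int -> 'cV[C]_m,
  (forall k, jacobi A B f k - z *: f k = site_basis l j k) /\
  (forall k i, normc (f k i 0) <= D * q ^+ `|k - l|%N).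
Proof.
have [f fP] := neumann_converges; exists f; split; last first.
  move=> k i; have := fP `|k - l|%N k i.
  (* For [n] below the distance from [k] to [l], the [n]-th iterate does not reach [k]: the tail
     bound is thus a decay bound, which puts [f] in [l2]. *)
  suff -> : neumann `|k - l| k = 0 by rewrite subr0.
  rewrite /neumann big1// => n _; rewrite iter_jacobi_far ?scaler0//.
  by have := ltn_ord n; lia.
move=> k; apply/eqP; rewrite -subr_eq0; apply/eqP/matrixP => i i0.
rewrite ord1 [RHS]mxE; apply: eq0_normc; apply/eqP; rewrite eq_le normc_ge0 andbT.
(* The residual at [f] is bounded by the errors of H f and of z f plus the residual of the partial
   sum, all of order [q ^+ N]. *)
apply: (@le0_geometric _ (K * D + normc z * D + 1)) => N.
have fE : f = fun k => 1 *: neumann N k + (f k - neumann N k).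
  by apply: funext => k'; rewrite scale1r addrC subrK.
have -> : jacobi A B f k - z *: f k - site_basis l j k =
    jacobi A B (fun k => f k - neumann N k) k - z *: (f k - neumann N k)
    - z ^- N *: F N k.
  rewrite {1}fE jacobiD scale1r scalerBr.
  move: (jacobi _ _ _ k) (neumann_residual N k) => J /(canRL (subrK _)) ->.
  move: (jacobi _ _ _ k) => J'.
  by apply/matrixP => r s; rewrite !mxE; ring.
have t0 : 0 <= D * q ^+ N by rewrite mulr_ge0 ?exprn_ge0.
have Jle := bdd t0 (fP N) k i.
have fle : normc ((z *: (f k - neumann N k)) i 0) <= normc z * (D * q ^+ N).
  by rewrite mxE normcM ler_wpM2l ?normc_ge0//; exact: fP.
have Fle : normc ((z ^- N *: F N k) i 0) <= q ^+ N.
  rewrite mxE normcM normcV normcX /q expr_div_n mulrC.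
  rewrite ler_wpM2r ?invr_ge0 ?exprn_ge0 ?normc_ge0//.
  have := iter_jacobi_bounded N K0 ler01 bdd (@site_basis_bounded R m l j) k i.
  by rewrite mulr1.
move: Jle fle Fle.
move: (jacobi A B _ k) (z *: _) (z ^- N *: _) => X Y Z Xle Yle Zle.
rewrite !mxE.
apply: (le_trans (normcB_le _ _)).
apply: (le_trans (lerD (normcB_le _ _) (lexx _))).
apply: (le_trans (lerD (lerD Xle Yle) Zle)).
by rewrite !mulrDl mul1r !mulrA.
Qed.

Local Notation r := (resolvent A B z (site_basis l j)).

Lemma resolvent_spec :
  l2 r /\ forall k, jacobi A B r k - z *: r k = site_basis l j k.
Proof.
have [f [fE fle]] := resolvent_equation_solvable.
pose T (f : int -> 'cV[C]_m) k := jacobi A B f k - z *: f k.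
(* ['pinv] yields a preimage in [l2] of any point in the image; the decaying solution shows that
   [site_basis l j] is one. *)
have im : [set T f | f in l2] (site_basis l j).
  by exists f; [exact: geometric_l2 fle|exact: funext].
split.
  have := @surjpinv_image_sub _ _ (fun=> 0) l2 [set T f | f in l2] T
    (fun _ => id).
  by apply; exists (site_basis l j).
have /= := @pinvK _ _ (fun=> 0) l2 T (site_basis l j).
rewrite inE => /(_ im) /= TE k.
by have := congr1 (fun g => g k) TE.
Qed.

(** Membership in [l2] makes the supremum S of the entries finite; then z r = H r - e, for e the
    basis vector, gives |z| S <= K S + 1. *)
Lemma resolvent_bounded : bounded_seq r (1 / (normc z - K)).
Proof.
have [rl2 rE] := resolvent_spec; have [M rM] := l2_bounded rl2.
pose E := [set normc (r x.1 x.2 0) | x in [set: int * 'I_m]].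
have ubE : has_ubound E by exists M => _ [x _ <-]; exact: rM.
have rS : bounded_seq r (sup E).
  by move=> k i; apply: ub_le_sup => //; exists (k, i).
have S0 : 0 <= sup E by apply: le_trans (normc_ge0 _) (rS 0 j).
suff : sup E <= (1 + K * sup E) / normc z.
  rewrite ler_pdivlMr// => h k i; apply: (le_trans (rS k i)).
  by rewrite ler_pdivlMr ?subr_gt0//; lra.
apply: ge_sup; first by exists (normc (r 0 j 0)), (0, j).
move=> _ [[k i] _ <-] /=; rewrite ler_pdivlMr// mulrC -normcM.
have -> : z * r k i 0 = jacobi A B r k i 0 - site_basis l j k i 0.
  have := rE k; move: (jacobi _ _ _ _) (site_basis _ _ _) => J d <-.
  by rewrite !mxE opprB addrC subrK.
rewrite [leRHS]addrC; apply: (le_trans (normcB_le _ _)).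
apply: lerD; first exact: bdd.
exact: site_basis_bounded.
Qed.

Lemma resolvent_expansion N k i :
  normc (z ^+ N * r k i 0 + \sum_(n < N) z ^+ (N - n.+1) * F n k i 0) <=
  K ^+ N / (normc z - K).
Proof.
have [rl2 rE] := resolvent_spec.
have rec n k' : z *: iter n (jacobi A B) r k' =
    iter n.+1 (jacobi A B) r k' - F n k'.
  have := iter_jacobiD A B (- z) r (jacobi A B r) n.
  have -> : (fun k => - z *: r k + jacobi A B r k) = site_basis l j.
    by apply: funext => k''; rewrite -rE scaleNr addrC.
  move=> /(congr1 (fun g => g k')) ->.
  by rewrite iterSr scaleNr opprD opprK addrCA subrr addr0.
(* Iterating z r = H r - e gives an exact remainder, the [N]-th power of H applied to [r]. *)
have -> : z ^+ N * r k i 0 + \sum_(n < N) z ^+ (N - n.+1) * F n k i 0 =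
    iter N (jacobi A B) r k i 0.
  elim: N => [|N IHN]; first by rewrite big_ord0 addr0 mul1r.
  have : (z *: iter N (jacobi A B) r k + F N k) i 0 =
      iter N.+1 (jacobi A B) r k i 0.
    by rewrite rec subrK.
  rewrite mxE => <-; rewrite mxE -IHN mulrDr mulrA -exprS mulr_sumr -addrA.
  rewrite big_ord_recr /= subnn mul1r; congr (_ + (_ + _)).
  by apply: eq_bigr => n _; rewrite mulrA -exprS subnSK.
rewrite -[X in K ^+ N * X]mul1r; apply: iter_jacobi_bounded => //.
  by rewrite mul1r invr_ge0 subr_ge0 ltW.
exact: resolvent_bounded.
Qed.

End Resolvent.

(** * From the Green's matrix to the moments *)

Section GreenMoments.
Context {R : realType}.
Local Notation C := R[i].

(** By strong induction the earlier coefficients vanish, so the bound with [N.+1] terms isolates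
    [a N], and its right side tends to 0 as [y] grows. *)
Lemma laurent_coef_eq0 (a : nat -> C) (K c : R) : 0 <= K -> 0 <= c ->
  (forall y N, K < y ->
    normc (\sum_(n < N) Complex 0 y ^+ (N - n.+1) * a n) <=
    c * (K ^+ N / (y - K))) ->
  forall n, a n = 0.
Proof.
move=> K0 c0 aP n; have [N] := ubnP n.
elim: N n => // N IHN n; rewrite ltnS => nN.
case: (ltngtP n N) nN => // [/IHN//|-> _] {n}.
apply: eq0_normc; apply/eqP; rewrite eq_le normc_ge0 andbT leNgt.
apply/negP => t0.
set t := normc (a N) in t0; pose b := c * K ^+ N.+1.
have b0 : 0 <= b by rewrite mulr_ge0// exprn_ge0.
(* At [y = K + (b / t + 1)] the bound reads [t * (b / t + 1) <= b], that is [b + t <= b]. *)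
have yK : K < K + (b / t + 1) by rewrite ltrDl ltr_wpDl// divr_ge0// ltW.
have := aP _ N.+1 yK; rewrite big_ord_recr /= big1 ?add0r => [|i _]; last first.
  by rewrite IHN ?mulr0.
rewrite subnn mul1r -/t [K + _ - K]addrC addKr mulrA ler_pdivlMr; last first.
  by rewrite ltr_wpDl// divr_ge0// ltW.
by rewrite -/b mulrDr mulr1 mulrC divfK ?gt_eqF// gerDl leNgt t0.
Qed.

Context {m : nat}.
Implicit Types (A B : int -> 'M[C]_m).

Lemma green_expansion A B K y N k l i j :
  0 <= K -> bounded_jacobi A B K -> K < y ->
  normc (Complex 0 y ^+ N * green A B (Complex 0 y) k l i j +
    \sum_(n < N) Complex 0 y ^+ (N - n.+1) * moment A B n k l i j) <=
  K ^+ N / (y - K).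
Proof.
move=> K0 bdd Ky; have yE : normc (Complex 0 y) = y.
  by rewrite /= expr0n add0r sqrtr_sqr ger0_norm// ltW// (le_lt_trans K0).
rewrite /green mxE; under eq_bigr do rewrite mxE.
rewrite -[X in _ / (X - K)]yE; apply: resolvent_expansion => //.
by rewrite yE.
Qed.

(** Sums over a list of blocks treat single blocks and the symmetrised datum of case (ii) alike. *)
Lemma green_sum_moments A1 B1 A2 B2 (s : seq (int * int)) :
  jacobi_coefficients A1 B1 -> jacobi_coefficients A2 B2 ->
  (forall z : C, 0 < complex.Im z ->
    \sum_(p <- s) green A1 B1 z p.1 p.2 = \sum_(p <- s) green A2 B2 z p.1 p.2) ->
  forall n, \sum_(p <- s) moment A1 B1 n p.1 p.2 =
    \sum_(p <- s) moment A2 B2 n p.1 p.2.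
Proof.
move=> /jacobi_coefficients_bounded[K1 [K10 bdd1]].
move=> /jacobi_coefficients_bounded[K2 [K20 bdd2]] gE n.
pose K := K1 + K2.
have K0 : 0 <= K by rewrite addr_ge0 ?ltW.
have {}bdd1 : bounded_jacobi A1 B1 K.
  by apply: bounded_jacobi_le bdd1; rewrite lerDl ltW.
have {}bdd2 : bounded_jacobi A2 B2 K.
  by apply: bounded_jacobi_le bdd2; rewrite lerDr ltW.
apply/matrixP => i j; apply/eqP; rewrite -subr_eq0 !summxE -sumrB; apply/eqP.
pose a n := \sum_(p <- s)
  (moment A1 B1 n p.1 p.2 i j - moment A2 B2 n p.1 p.2 i j).
(* Each block contributes two expansion errors, one per operator, whence the 2. *)
apply: (@laurent_coef_eq0 a K (\sum_(p <- s) 2)) => // [|y N Ky].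
  exact: sumr_ge0.
have y0 : 0 < complex.Im (Complex 0 y) by exact: le_lt_trans Ky.
set z := Complex 0 y in y0 *.
pose e A B p := z ^+ N * green A B z p.1 p.2 i j +
  \sum_(n < N) z ^+ (N - n.+1) * moment A B n p.1 p.2 i j.
(* The Green's terms cancel by the equality of the data, so only expansion errors remain. *)
have -> : \sum_(n < N) z ^+ (N - n.+1) * a n =
    \sum_(p <- s) (e A1 B1 p - e A2 B2 p).
  rewrite sumrB !big_split /= -!mulr_sumr -!summxE gE// opprD addrACA subrr.
  rewrite add0r.
  rewrite ![\sum_(p <- s) \sum_(n < N) _]exchange_big /= -sumrB.
  apply: eq_bigr => n' _.
  by rewrite -!mulr_sumr -mulrBr /a sumrB.
apply: (le_trans (normc_sum _ _ _)); rewrite mulr_suml; apply: ler_sum => p _.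
apply: (le_trans (normcB_le _ _)); rewrite mulr_natl mulr2n.
by apply: lerD; exact: green_expansion.
Qed.

Lemma green_moments A1 B1 A2 B2 k l :
  jacobi_coefficients A1 B1 -> jacobi_coefficients A2 B2 ->
  (forall z : C, 0 < complex.Im z -> green A1 B1 z k l = green A2 B2 z k l) ->
  forall n, moment A1 B1 n k l = moment A2 B2 n k l.
Proof.
move=> h1 h2 gE n; have := @green_sum_moments _ _ _ _ [:: (k, l)] h1 h2 _ n.
by rewrite !big_seq1; apply=> z z0; rewrite !big_seq1 gE.
Qed.

End GreenMoments.

Theorem theorem4p6 (R : realType) (m : nat) (hm : (0 < m)%N) (k0 : int)
    (A1 B1 A2 B2 : int -> 'M[R[i]]_m)
    (h1 : jacobi_coefficients A1 B1) (h2 : jacobi_coefficients A2 B2) :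
  [/\ (forall z : R[i], 0 < complex.Im z ->
          diag_green A1 B1 z k0 = diag_green A2 B2 z k0 /\
          green A1 B1 z k0 (k0 + 1) = green A2 B2 z k0 (k0 + 1)) ->
        A1 = A2 /\ B1 = B2,
      (forall z : R[i], 0 < complex.Im z ->
          diag_green A1 B1 z k0 = diag_green A2 B2 z k0 /\
          green A1 B1 z k0 (k0 + 1) + green A1 B1 z (k0 + 1) k0 =
          green A2 B2 z k0 (k0 + 1) + green A2 B2 z (k0 + 1) k0) ->
        A1 = A2 /\ B1 = B2
    & (forall z : R[i], 0 < complex.Im z ->
          diag_green A1 B1 z k0 = diag_green A2 B2 z k0 /\
          diag_green A1 B1 z (k0 + 1) = diag_green A2 B2 z (k0 + 1)) ->
        A1 k0 = A2 k0 ->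
        A1 = A2 /\ B1 = B2].
Proof.
have [A1pos _ _] := h1; have [A2pos _ _] := h2.
split=> [data|data|data Ak0].
all: have diag := green_moments h1 h2 (fun z z0 => (data z z0).1).
- apply: (moments_determine_i A1pos A2pos diag).
  by apply: green_moments => // z /data[].
- apply: (moments_determine_ii A1pos A2pos diag) => n.
  have := @green_sum_moments _ _ _ _ _ _
    [:: (k0, k0 + 1); (k0 + 1, k0)] h1 h2 _ n.
  rewrite !big_cons !big_nil !addr0; apply=> z /data[_].
  by rewrite !big_cons !big_nil !addr0.
- apply: (moments_determine_iii A1pos A2pos diag) => //.
  by apply: green_moments => // z /data[].
Qed.
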